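(* Let $(\xi_i)_{i\in\mathbb{N}}$ be an exchangeable sequence of real-valued random variables with finite moments of all orders, with de Finetti representation $(T,\mathcal{T},\mu)$, $\Lambda$, variances $v(\tau)$, and let $\nu$ be the push forward of $\mu$ under $\tau\mapsto v(\tau)$. The Borel probability measure $\sigma_\mu$ on $\mathbb{R}$ defined by $$\int f(x)\,d\sigma_\mu(x)=\int_T\int f(x)\,d\sigma_{v(\tau)}(x)\,d\mu(\tau)\qquad\text{for all bounded continuous } f:\mathbb{R}\to\mathbb{R}$$ is symmetric in the sense that $\sigma_\mu(A)=\sigma_\mu(-A)$ for all Borel sets $A$. Moreover, $$\sigma_\mu=\mu(\{\tau: v(\tau)=0\})\,\delta_0+\sigma_\mu^{abs}$$ with $\sigma_\mu^{abs}$ absolutely continuous with Lebesgue density $$\rho_\mu(x):=\frac{d\sigma_\mu^{abs}}{dx}(x)=\frac{1}{2\pi}\int_{x^2/4}^\infty\frac{\sqrt{4v-x^2}}{v}\,d\nu(v)<\infty\qquad\text{for }0<|x|<\infty.$$ The even function $\rho_\mu$ is decreasing (not necessarily strictly) with $|x|$.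
   Context: An infinite sequence $(\xi_i)_{i\in\mathbb{N}}$ of real random variables is exchangeable if for every $n$ and every permutation $\pi$ of $\{1,\dots,n\}$ the vectors $(\xi_1,\dots,\xi_n)$ and $(\xi_{\pi(1)},\dots,\xi_{\pi(n)})$ have the same distribution. De Finetti representation: there are a probability space $(T,\mathcal{T},\mu)$ and a measurable map $\Lambda:T\to\mathcal{M}_1(\mathbb{R})$, $\tau\mapsto\Lambda_\tau$, into the space of Borel probability measures on $\mathbb{R}$ (with the topology of weak convergence) such that $\mathbb{P}((\xi_i)_i\in F)=\int_T P_{\Lambda_\tau}(F)\,d\mu(\tau)$ for all measurable $F\subset\mathbb{R}^{\mathbb{N}}$, where $P_\lambda$ denotes the infinite product measure $\bigotimes_{i\in\mathbb{N}}\lambda$ on $\mathbb{R}^{\mathbb{N}}$. By convention the representation is chosen such that all moments of $\Lambda_\tau$ are finite for every $\tau\in T$. Put $m_k(\tau):=\int x^k\,d\Lambda_\tau(x)$ and $v(\tau):=m_2(\tau)-m_1(\tau)^2\geq 0$. For $v>0$, $\sigma_v$ is the probability measure on $\mathbb{R}$ with Lebesgue density $\frac{1}{2\pi v}\sqrt{(4v-x^2)_+}$, where $g_+=\max(g,0)$; $\sigma_0:=\delta_0$ (Dirac measure at $0$). *)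

(* Defs.v *)
From HB Require Import structures.
From mathcomp Require Import all_boot all_order all_fingroup all_algebra.
From mathcomp Require Import all_classical all_reals all_analysis.
From mathcomp Require Import measurable_realfun.

Set Implicit Arguments.
Unset Strict Implicit.
Unset Printing Implicit Defensive.

Import Order.TTheory GRing.Theory Num.Theory.
Import numFieldNormedType.Exports.

Local Open Scope classical_set_scope.
Local Open Scope ring_scope.

Section exchangeability.
Context {R : realType} {d : measure_display} {Omega : measurableType d}.
Variables (P : probability Omega R) (xi : nat -> {RV P >-> R}).

Definition exchangeable : Prop :=
  forall (n : nat) (s : 'S_n) (A : set (n.-tuple R)), measurable A ->
    P ((fun w => [tuple xi (s i) w | i < n]) @^-1` A) =
    P ((fun w => [tuple xi i w | i < n]) @^-1` A).

Definition finite_moments : Prop :=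
  forall i k : nat, P.-integrable [set: Omega] (fun w => (xi i w ^+ k)%:E).

End exchangeability.
Arguments exchangeable {R d Omega P} xi.
Arguments finite_moments {R d Omega P} xi.

Section weak_convergence.
Variable R : realType.

Definition bcfun := {f : R -> R | continuous f /\ bounded_fun f}.

HB.instance Definition _ := gen_eqMixin bcfun.
HB.instance Definition _ := gen_choiceMixin bcfun.

(* The topology of weak convergence on M_1(R) is the initial topology of the
   evaluations Q |-> \int f dQ, for f bounded and continuous.                *)
Definition bc_integrals (Q : probability R R) :
    prod_topology (fun _ : bcfun => R) :=
  fun f => \int[Q]_x sval f x.

Definition weakM1 : Type := initial_topology bc_integrals.

HB.instance Definition _ := Topological.on weakM1.
HB.instance Definition _ := Pointed.on weakM1.

Definition borelM1 := g_sigma_algebraType (@open weakM1).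

End weak_convergence.

Section infinite_product.
Variable R : realType.

Definition coordinate_sets : set (set (nat -> R)) :=
  [set A | exists (i : nat) (B : set R),
     measurable B /\ A = (fun x : nat -> R => x i) @^-1` B].

(* R^N with the product sigma-algebra *)
Definition RN := g_sigma_algebraType coordinate_sets.

(* The infinite product measure is the unique probability measure on R^N
   whose values on finite-dimensional rectangles are the products below.     *)
Definition is_infinite_product (lam : probability R R)
    (Q : probability RN R) : Prop :=
  forall (n : nat) (A : 'I_n -> set R), (forall i, measurable (A i)) ->
    (Q [set x : nat -> R | forall i : 'I_n, A i (x i)] =
     \prod_(i < n) lam (A i))%E.

End infinite_product.

Record de_finetti_representation {R : realType}
    {d : measure_display} {Omega : measurableType d} {P : probability Omega R}
    (xi : nat -> {RV P >-> R})
    {dT : measure_display} {T : measurableType dT}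
    (mu : probability T R) (Lam : T -> probability R R) : Prop := {
  de_finetti_measurable :
    measurable_fun [set: T] (Lam : T -> borelM1 R) ;
  de_finetti_law :
    exists2 PLam : T -> probability (RN R) R,
      forall tau, is_infinite_product (Lam tau) (PLam tau)
      & forall F : set (RN R), measurable F ->
          P [set w | F (fun i => xi i w)] = (\int[mu]_tau PLam tau F)%E ;
  de_finetti_moments :
    forall (tau : T) (k : nat),
      (Lam tau).-integrable [set: R] (fun x => (x ^+ k)%:E) }.

Definition moment {R : realType} (lam : probability R R) (k : nat) : R :=
  \int[lam]_x (x ^+ k).

Definition var {R : realType} (lam : probability R R) : R :=
  moment lam 2 - moment lam 1 ^+ 2.

Definition semicircle_pdf {R : realType} (v x : R) : R :=
  (2 * pi * v)^-1 * Num.sqrt (Num.max (4 * v - x ^+ 2) 0).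

Definition semicircle {R : realType} (v : R) : set R -> \bar R :=
  if v == 0 then \d_(0 : R)
  else fun A => (\int[lebesgue_measure]_(x in A) (semicircle_pdf v x)%:E)%E.

(* For v < 0 the density vanishes identically and semicircle v is the zero
   measure; only v >= 0 is meaningful.                                       *)
Section semicircle_measure.
Variables (R : realType) (v : R).

Lemma semicircle_pdf_ge0 x : 0 <= semicircle_pdf v x.
Proof.
have [v0|v0] := leP 0 v.
  by rewrite mulr_ge0 ?sqrtr_ge0// invr_ge0 !mulr_ge0// pi_ge0.
rewrite /semicircle_pdf max_r ?sqrtr0 ?mulr0//.
by rewrite subr_le0 (le_trans _ (sqr_ge0 x))// pmulr_rle0// ltW.
Qed.

Lemma measurable_semicircle_pdf : measurable_fun [set: R] (semicircle_pdf v).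
Proof.
apply: measurable_funM => //; apply: measurableT_comp => //.
  by apply: continuous_measurable_fun; exact: sqrt_continuous.
by apply: measurable_maxr => //; apply: measurable_funB => //;
  exact: exprn_measurable.
Qed.

Let semicircle0 : semicircle v set0 = 0%E.
Proof. by rewrite /semicircle; case: ifP; rewrite ?measure0 ?integral_set0. Qed.

Let semicircle_ge0 A : (0 <= semicircle v A)%E.
Proof.
rewrite /semicircle; case: ifP => // _.
by apply: integral_ge0 => x _; rewrite lee_fin semicircle_pdf_ge0.
Qed.

Let semicircle_sigma_additive : semi_sigma_additive (semicircle v).
Proof.
rewrite /semicircle; case: ifP => _ F mF tF mUF.
  exact: measure_semi_sigma_additive.
rewrite ge0_integral_bigcup//=.
- apply: is_cvg_ereal_nneg_natsum_cond => n _ _.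
  by apply: integral_ge0 => x _; rewrite lee_fin semicircle_pdf_ge0.
- apply/measurable_EFinP; apply: measurable_funTS.
  exact: measurable_semicircle_pdf.
- by move=> x _; rewrite lee_fin semicircle_pdf_ge0.
Qed.

HB.instance Definition _ := isMeasure.Build _ _ _ (semicircle v)
  semicircle0 semicircle_ge0 semicircle_sigma_additive.

End semicircle_measure.

Definition is_semicircle_mixture {R : realType}
    {dT : measure_display} {T : measurableType dT}
    (mu : probability T R) (v : T -> R) (sigma : probability R R) : Prop :=
  forall f : R -> R, continuous f -> bounded_fun f ->
    (\int[sigma]_x (f x)%:E =
     \int[mu]_tau \int[semicircle (v tau)]_x (f x)%:E)%E.

(* Extended-real valued: the value at x = 0, which is irrelevant to the
   density, may be infinite.                                                 *)
Definition mixture_density {R : realType} (nu : set R -> \bar R) (x : R) :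
    \bar R :=
  ((2 * pi)^-1%:E *
   \int[nu]_(t in `[(x ^+ 2 / 4)%R, +oo[)
     (Num.sqrt (4 * t - x ^+ 2) / t)%:E)%E.

(* Main.v *)
(** The semicircle law of variance w is a probability measure depending
    measurably on w, and tau |-> v tau is measurable because each moment is the
    pointwise limit of integrals of truncated, hence bounded continuous, powers.
    So sigma is the mixture A |-> \int semicircle (v tau) A dmu, that is, a bind
    in the Giry monad; it is determined by its integrals of bounded continuous
    functions because these approximate indicators of open half-lines.
    By Tonelli, the mixture of the absolutely continuous parts has density
    \int semicircle_pdf (v tau) x dmu, which equals rho x after transport to nu.
    Symmetry and monotonicity then hold integrand by integrand, and finiteness
    follows from semicircle_pdf w x <= (2 pi)^-1 * 4 / |x|, uniformly in w. *)

Require Import Defs.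
From HB Require Import structures.
From mathcomp Require Import all_boot all_order all_fingroup all_algebra.
From mathcomp Require Import all_classical all_reals all_analysis.
From mathcomp Require Import measurable_realfun giry ring lra.

Set Implicit Arguments.
Unset Strict Implicit.
Unset Printing Implicit Defensive.

Import Order.TTheory GRing.Theory Num.Theory.
Import numFieldNormedType.Exports.

Local Open Scope classical_set_scope.
Local Open Scope ring_scope.

(** * Total mass of the semicircle density *)

Section semicircle_mass.
Context {R : realType}.
Local Notation mu := (@lebesgue_measure R).

Lemma derivable_continuous_bnd (f : R -> R) (a b : R) :
  (forall x, derivable f x 1) -> derivable_oo_LRcontinuous f a b.
Proof.
move=> df.
have cf x : {for x, continuous f}.
  exact/differentiable_continuous/derivable1_diffP/df.
split => [x _//||]; [exact/cvg_at_right_filter/cf|exact/cvg_at_left_filter/cf].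
Qed.

Lemma integral_cos2_pihalf (c : R) :
  (\int[mu]_(t in `[(- (pi / 2))%R, (pi / 2)%R])
     (c * cos t ^+ 2)%:E = (c * (pi / 2))%:E)%E.
Proof.
pose F (t : R) : R := c * 2^-1 * (t + sin t * cos t).
have dF (t : R) : is_derive t (1 : R) F (c * cos t ^+ 2).
  rewrite /F; apply: is_derive_eq; rewrite /GRing.scale/=.
  by rewrite mulrN -!expr2 sin2cos2; field.
have FF : derive1 F = fun t => c * cos t ^+ 2.
  by apply/funext => t; rewrite derive1E; exact: derive_val.
rewrite (@continuous_FTC2 _ _ F).
- rewrite -EFinB /F sinN cosN cos_pihalf !mulr0 !addr0; by congr EFin; field.
- by have := pi_gt0 R; lra.
- apply: continuous_subspaceT => t.
  apply: cvgM; first exact: cvg_cst.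
  by apply: cvgM; exact: continuous_cos.
- by apply: derivable_continuous_bnd => t; exact: ex_derive.
- by move=> t _; rewrite FF.
Qed.

(* Substitution x = 2 sqrt w sin t. *)
Lemma integral_half_disc (w : R) : 0 < w ->
  (\int[mu]_(x in `[(- (2 * Num.sqrt w))%R, (2 * Num.sqrt w)%R])
     (Num.sqrt (4 * w - x ^+ 2))%:E = (2 * pi * w)%:E)%E.
Proof.
move=> w0; pose s : R := 2 * Num.sqrt w.
have s0 : 0 < s by rewrite mulr_gt0// sqrtr_gt0.
have s2 : s ^+ 2 = 4 * w by rewrite exprMn sqr_sqrtr ?ltW//; ring.
pose F (t : R) : R := s * sin t.
have dF (t : R) : is_derive t (1 : R) F (s * cos t).
  by rewrite /F; apply: is_derive_eq; rewrite /GRing.scale/= ?mulr0 ?addr0.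
have FF : derive1 F = fun t => s * cos t.
  by apply/funext => t; rewrite derive1E; exact: derive_val.
have cF' : continuous (derive1 F : R -> R).
  rewrite FF => t; apply: cvgM; first exact: cvg_cst.
  exact: continuous_cos.
have pi2 : - (pi / 2) <= pi / 2 :> R by have := pi_ge0 R; lra.
have Fl : F (- (pi / 2)) = - s by rewrite /F sinN sin_pihalf mulrN1.
have Fr : F (pi / 2) = s by rewrite /F sin_pihalf mulr1.
(* The endpoints are written as values of [F] at -pi/2 and pi/2, the shape the substitution rule
   expects. *)
rewrite -[X in `[(- X)%R, _]]/s -/s -{1}Fl -Fr integration_by_substitution_increasing//.
- transitivity (\int[mu]_(t in `[(- (pi / 2))%R, (pi / 2)%R])
     (4 * w * cos t ^+ 2)%:E)%E; last first.
    by rewrite integral_cos2_pihalf; by congr EFin; field.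
  apply: eq_integral => t; rewrite inE/= in_itv/= => tpi; congr EFin.
  rewrite !fctE/= FF/= -s2 /F.
  have -> : s ^+ 2 - (s * sin t) ^+ 2 = (s * cos t) ^+ 2.
    by rewrite -[s ^+ 2]mulr1 -(cos2Dsin2 t); ring.
  (* The cosine is nonnegative on this interval, so the root of (s cos t)^2 is s cos t without
     absolute value. *)
  have c0 : 0 <= cos t by rewrite cos_ge0_pihalf.
  by rewrite sqrtr_sqr ger0_norm ?mulr_ge0// ?ltW//; ring.
- by move=> x y xI yI xy; rewrite /F ltr_pM2l// ltr_sin.
- by apply: cvgP; exact/cvg_at_right_filter/cF'.
- by apply: cvgP; exact/cvg_at_left_filter/cF'.
- by apply: derivable_continuous_bnd => t; exact: ex_derive.
- apply: continuous_subspaceT => x; apply: continuous_comp.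
    apply: cvgB; first exact: cvg_cst.
    by apply: cvgM; exact: cvg_id.
  exact: sqrt_continuous.
Qed.

(** [Num.sqrt] is 0 at negative reals, so it performs the truncation at 0 by itself. *)
Lemma semicircle_pdfE (w x : R) :
  semicircle_pdf w x = (2 * pi * w)^-1 * Num.sqrt (4 * w - x ^+ 2).
Proof.
rewrite /semicircle_pdf; congr (_ * _).
by have [h|//] := leP (4 * w - x ^+ 2) 0; rewrite sqrtr0 ler0_sqrtr.
Qed.

Lemma semicircle_pdf0 (x : R) : semicircle_pdf 0 x = 0.
Proof. by rewrite /semicircle_pdf mulr0 invr0 mul0r. Qed.

Lemma semicircle_pdf_le0 (w x : R) : w <= 0 -> semicircle_pdf w x = 0.
Proof.
move=> w0; rewrite semicircle_pdfE ler0_sqrtr ?mulr0//.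
by have := sqr_ge0 x; lra.
Qed.

Lemma semicircle_pdfN (w x : R) : semicircle_pdf w (- x) = semicircle_pdf w x.
Proof. by rewrite /semicircle_pdf sqrrN. Qed.

Lemma integral_semicircle_pdf (w : R) : 0 < w ->
  (\int[mu]_x (semicircle_pdf w x)%:E = 1)%E.
Proof.
move=> w0; pose s : R := 2 * Num.sqrt w.
have s0 : 0 < s by rewrite mulr_gt0// sqrtr_gt0.
have s2 : s ^+ 2 = 4 * w by rewrite exprMn sqr_sqrtr ?ltW//; ring.
have c0 : 0 < 2 * pi * w by rewrite !mulr_gt0// pi_gt0.
transitivity (\int[mu]_(x in `[(- s)%R, s]) (semicircle_pdf w x)%:E)%E.
  (* Outside [-s, s] one has x^2 > s^2 = 4w, so the radicand is negative and the density
     vanishes. *)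
  rewrite [RHS]integral_mkcond; apply: eq_integral => x _.
  rewrite patchE mem_setE; case: ifPn => //; rewrite in_itv/= -ler_norml -ltNge => xs.
  congr EFin; rewrite semicircle_pdfE ler0_sqrtr ?mulr0//.
  rewrite -s2 subr_le0 -[x ^+ 2]real_normK ?num_real//.
  by rewrite ler_sqr ?nnegrE ?normr_ge0 ?ltW.
under eq_integral do rewrite semicircle_pdfE EFinM.
rewrite ge0_integralZl//.
- by rewrite integral_half_disc// -EFinM mulVf// gt_eqF.
- apply/measurable_EFinP/measurable_funTS; apply: measurableT_comp.
    by apply: continuous_measurable_fun; exact: sqrt_continuous.
  by apply: measurable_funB => //; exact: exprn_measurable.
- by rewrite lee_fin invr_ge0 ltW.
Qed.

End semicircle_mass.

(** * The semicircle laws as a measurable kernel in the variance *)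

Section semicircle_kernel.
Context {R : realType}.
Local Notation mu := (@lebesgue_measure R).

(** Inversion is continuous only away from 0, so the line is split into the measurable singleton {0}
    and its open complement. *)
Lemma measurable_invr : measurable_fun [set: R] (@GRing.inv R).
Proof.
rewrite -(setUv [set 0 : R]); apply/measurable_funU => //.
  exact: measurableC.
split; first exact: measurable_fun_set1.
apply: open_continuous_measurable_fun.
  by apply: closed_openC; apply: closed_eq.
by move=> x; rewrite inE/= => /eqP; exact: inv_continuous.
Qed.

(** Joint measurability in variance and point is what Tonelli requires, first for the kernel and
    later for the density of the mixture. *)
Lemma measurable_semicircle_pdf2 :
  measurable_fun [set: R * R] (fun p => semicircle_pdf p.1 p.2).
Proof.
under eq_fun do rewrite semicircle_pdfE.
apply: measurable_funM.
  apply: (measurableT_comp measurable_invr).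
  by apply: measurable_funM.
apply: measurableT_comp.
  by apply: continuous_measurable_fun; exact: sqrt_continuous.
by apply: measurable_funB; [exact: measurable_funM|exact: measurable_funX].
Qed.

(* At w = 0 the density vanishes identically, since 0^-1 = 0. *)
Lemma semicircleE (w : R) (A : set R) : measurable A ->
  (semicircle w A = (\1_[set 0%R] w)%:E * \d_(0%R : R) A
                    + \int[mu]_(x in A) (semicircle_pdf w x)%:E)%E.
Proof.
move=> mA; rewrite /semicircle indicE classical_sets.in_set1.
have [->|w0] := eqVneq w 0; last by rewrite mul0e add0e.
rewrite mul1e [X in (_ + X)%E]integral0_eq ?adde0// => x _.
by rewrite semicircle_pdf0.
Qed.

Lemma semicircle_setT (w : R) : 0 <= w -> (semicircle w [set: R] = 1)%E.
Proof.
rewrite le_eqVlt => /predU1P[<-|w0].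
  by rewrite /semicircle eqxx diracT.
by rewrite /semicircle gt_eqF// integral_semicircle_pdf.
Qed.

(* For w < 0 the measure is zero, hence only a subprobability. *)
Let semicircle_setT_le1 (w : R) : (semicircle w [set: R] <= 1)%E.
Proof.
have [w0|w0] := leP 0 w; first by rewrite semicircle_setT.
rewrite /semicircle lt_eqF// integral0_eq// => x _.
by rewrite semicircle_pdf_le0// ltW.
Qed.

(** Points of [giry] are subprobabilities; with this instance the kernel is defined on the whole
    real line. *)
HB.instance Definition _ (w : R) := Measure_isSubProbability.Build _ _ _
  (semicircle w) (semicircle_setT_le1 w).

Lemma measurable_integral_semicircle_pdf (A : set R) : measurable A ->
  measurable_fun [set: R] (fun w => \int[mu]_(x in A) (semicircle_pdf w x)%:E)%E.
Proof.
move=> mA; under eq_fun do rewrite integral_mkcond.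
(* With the indicator of [A] absorbed, the integral becomes a section integral of a nonnegative
   jointly measurable function. *)
pose f (p : R * R) := ((semicircle_pdf p.1 p.2) * \1_A p.2)%:E.
rewrite (_ : (fun _ => _) = fubini_F mu f); last first.
  apply/funext => w; apply: eq_integral => x _.
  by rewrite patchE /f/= indicE; case: ifPn; rewrite ?mulr1 ?mulr0.
apply: measurable_fun_fubini_tonelli_F.
  apply/measurable_EFinP; apply: measurable_funM.
    exact: measurable_semicircle_pdf2.
  by apply: measurableT_comp => //; exact: measurable_indic.
by move=> p; rewrite lee_fin mulr_ge0// semicircle_pdf_ge0.
Qed.

Lemma measurable_semicircle (A : set R) : measurable A ->
  measurable_fun [set: R] (fun w => semicircle w A).
Proof.
move=> mA; under eq_fun do rewrite semicircleE//.
apply: emeasurable_funD; last exact: measurable_integral_semicircle_pdf.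
by apply: emeasurable_funM => //; apply/measurable_EFinP; exact: measurable_indic.
Qed.

Lemma image_oppE (A : set R) : [set - x | x in A] = -%R @^-1` A.
Proof.
apply/seteqP; split => [_ [x Ax <-]|x Ax]; first by rewrite /preimage/= opprK.
by exists (- x); rewrite ?opprK.
Qed.

Lemma measurable_image_opp (A : set R) : measurable A ->
  measurable [set - x | x in A].
Proof.
by move=> mA; rewrite image_oppE -[_ @^-1` _]setTI; exact: oppr_measurable.
Qed.

(** The possible atom sits at 0, which negation fixes; the remaining part has an even density, and
    Lebesgue measure is invariant under negation. *)
Lemma semicircleN (w : R) (A : set R) : measurable A ->
  semicircle w [set - x | x in A] = semicircle w A.
Proof.
move=> mA; rewrite !semicircleE//; last exact: measurable_image_opp.
congr (_ * _ + _)%E.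
  rewrite !diracE image_oppE; suff -> : (0 \in -%R @^-1` A) = (0 \in A) by [].
  by apply/idP/idP; rewrite !inE /preimage/= oppr0.
rewrite image_oppE.
transitivity (\int[pushforward mu (-%R : _ -> measurableTypeR R)]_(x in A)
  (semicircle_pdf w x)%:E)%E; last first.
  by apply: eq_measure_integral => B mB BA; exact: lebesgue_measureN.
rewrite ge0_integral_pushforward//=.
- by apply: eq_integral => x _; rewrite semicircle_pdfN.
- by apply/measurable_EFinP; apply: measurable_funTS; exact: measurable_semicircle_pdf.
- by move=> x _; rewrite lee_fin semicircle_pdf_ge0.
Qed.

End semicircle_kernel.

(** * Measurability and nonnegativity of the variance *)

Section variance.
Context {R : realType}.

Lemma continuous_bc_integral (f : bcfun R) :
  continuous (fun Q : weakM1 R => (\int[Q]_x sval f x)%R : R).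
Proof.
move=> Q.
apply: (@continuous_comp (weakM1 R) (prod_topology (fun _ : bcfun R => R)) R
  (@bc_integrals R) (proj f) Q).
  exact: (@initial_continuous (probability R R : choiceType) _ (@bc_integrals R)).
exact: proj_continuous.
Qed.

(** By weak continuity, preimages of open intervals are open, hence among the generators of the
    sigma-algebra of [borelM1]. *)
Lemma measurable_bc_integral (f : bcfun R) :
  measurable_fun [set: borelM1 R] (fun Q : borelM1 R => (\int[Q]_x sval f x)%R : R).
Proof.
apply: (measurability _ (RGenOpens.measurableE R)) => _ [_ [a [b ->]] <-].
rewrite setTI; apply: sub_sigma_algebra.
by move/continuousP: (@continuous_bc_integral f); apply; exact: interval_open.
Qed.

(** Truncation at height n: it makes an unbounded continuous integrand such as a power a legitimate
    test function for weak convergence. *)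
Definition clamp (n : nat) (y : R) : R := Num.max (- n%:R) (Num.min n%:R y).

Lemma clamp_continuous n : continuous (clamp n).
Proof.
move=> y; apply: (@continuous_max R R (cst (- n%:R)) (fun y => Num.min n%:R y)).
  exact: cst_continuous.
by apply: (@continuous_min R R (cst n%:R) id); [exact: cst_continuous|exact: cvg_id].
Qed.

Lemma normr_clamp_le n y : `|clamp n y| <= n%:R.
Proof.
rewrite /clamp ler_norml le_max lexx/= ge_max ge_min lexx/= andbT.
by rewrite (@le_trans _ _ 0)// oppr_le0.
Qed.

Lemma normr_clamp_le_id n y : `|clamp n y| <= `|y|.
Proof.
have n0 := ler0n R n; have y0 := normr_ge0 y; have yy := lerNnormlW (lexx `|y|).
rewrite /clamp ler_norml le_max le_min ge_max ge_min ler_norm yy !orbT !andbT.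
by apply/andP; split; [apply/orP; right|]; lra.
Qed.

Lemma clamp_id n y : `|y| <= n%:R -> clamp n y = y.
Proof. by rewrite ler_norml => /andP[? ?]; rewrite /clamp min_r// max_r. Qed.

Lemma cvg_clamp y : clamp n y @[n --> \oo] --> y.
Proof.
apply: cvg_near_cst; near=> n; apply: clamp_id.
by near: n; exact: nbhs_infty_ger.
Unshelve. all: by end_near. Qed.

Lemma clamp_comp_bc (g : R -> R) : continuous g -> forall n,
  continuous (clamp n \o g) /\ bounded_fun (clamp n \o g).
Proof.
move=> cg n; split.
  by move=> x; apply: continuous_comp; [exact: cg|exact: clamp_continuous].
exists n%:R; split; first by rewrite num_real.
by move=> M nM x _ /=; rewrite (le_trans (normr_clamp_le _ _))// ltW.
Qed.

(** Dominated convergence: truncation never increases absolute values, so |g| dominates the whole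
    sequence. *)
Lemma cvg_integral_clamp (Q : probability R R) (g : R -> R) :
  continuous g -> Q.-integrable [set: R] (EFin \o g) ->
  \int[Q]_x (clamp n (g x)) @[n --> \oo] --> \int[Q]_x g x.
Proof.
move=> cg ig.
have mg : measurable_fun [set: R] g by exact: continuous_measurable_fun.
have mc n : measurable_fun [set: R] (fun x => clamp n (g x)).
  by apply: continuous_measurable_fun; exact: (clamp_comp_bc cg n).1.
have cvgg : {ae Q, forall x, [set: R] x ->
    (clamp n (g x))%:E @[n --> \oo] --> (EFin \o g) x}.
  by apply: aeW => x _; apply/fine_cvgP; split; [exact: nearW|exact: cvg_clamp].
have boundg : {ae Q, forall x n, [set: R] x ->
    (`|(clamp n (g x))%:E| <= (abse \o (EFin \o g)) x)%E}.
  by apply: aeW => x n _; rewrite /= lee_fin normr_clamp_le_id.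
have mcE n : measurable_fun [set: R] (fun x => (clamp n (g x))%:E).
  exact/measurable_EFinP.
have mgE : measurable_fun [set: R] (EFin \o g) by exact/measurable_EFinP.
have [_ _ h] := dominated_convergence measurableT mcE mgE cvgg
  (integrable_abse ig) boundg.
by apply: fine_cvg; rewrite fineK//; exact: integrable_fin_num.
Qed.

Lemma measurable_integral_continuous d (T : measurableType d)
    (Lam : T -> probability R R) (g : R -> R) :
  measurable_fun [set: T] (Lam : T -> borelM1 R) -> continuous g ->
  (forall tau, (Lam tau).-integrable [set: R] (EFin \o g)) ->
  measurable_fun [set: T] (fun tau => \int[Lam tau]_x g x)%R.
Proof.
move=> mLam cg ig.
apply: (@measurable_fun_cvg _ _ _ _
  (fun n tau => \int[Lam tau]_x (clamp n (g x)))%R).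
- move=> n.
  exact: (measurableT_comp (measurable_bc_integral (exist _ _ (clamp_comp_bc cg n))) mLam).
- by move=> tau _; exact: cvg_integral_clamp.
Qed.

Lemma measurable_var d (T : measurableType d) (Lam : T -> probability R R) :
  measurable_fun [set: T] (Lam : T -> borelM1 R) ->
  (forall tau k, (Lam tau).-integrable [set: R] (fun x => (x ^+ k)%:E)) ->
  measurable_fun [set: T] (fun tau => var (Lam tau)).
Proof.
move=> mLam iLam.
have mm k : measurable_fun [set: T] (fun tau => moment (Lam tau) k).
  apply: measurable_integral_continuous => //.
  - exact: exprn_continuous.
  - by move=> tau; exact: iLam.
by rewrite /var; apply: measurable_funB => //; exact: measurable_funX.
Qed.

(** The variance is the integral of (x - m)^2 with m the mean; expanding the square gives m^2 as
    constant term because [Q] has mass 1. *)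
Lemma var_ge0 (Q : probability R R) :
  (forall k, Q.-integrable [set: R] (fun x => (x ^+ k)%:E)) -> 0 <= var Q.
Proof.
move=> iQ; pose m := moment Q 1.
have i1 := iQ 1%N; have i2 := iQ 2%N.
have ic : Q.-integrable [set: R] (EFin \o cst (m ^+ 2)).
  exact: finite_measure_integrable_cst.
have im : Q.-integrable [set: R] (EFin \o (fun x => (2 * m) * x ^+ 1)).
  exact: (integrableZl measurableT (2 * m) i1).
suff -> : var Q = \int[Q]_x ((x - m) ^+ 2).
  by apply: Rintegral_ge0 => x _; exact: sqr_ge0.
transitivity (\int[Q]_x ((x ^+ 2 - (2 * m) * x ^+ 1) + m ^+ 2)); last first.
  by apply: eq_Rintegral => x _; ring.
rewrite RintegralD; [|exact: measurableT|exact: (integrableB measurableT i2 im)|by []].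
rewrite RintegralB; [|exact: measurableT|exact: i2|exact: im].
rewrite RintegralZl; [|exact: measurableT|exact: i1].
rewrite Rintegral_cst//= [X in fine X](@probability_setT _ _ _ Q)/=.
rewrite -[\int[Q]_x x ^+ 2]/(moment Q 2) -[\int[Q]_x x ^+ 1]/m /var -/m.
by ring.
Qed.

End variance.

(** * Bounded continuous functions determine a probability measure *)

Section weak_uniqueness.
Context {R : realType}.

(** For n > 0 this is 0 up to a, rises with slope n, and equals 1 from a + 1/n on: a continuous
    approximation from below of the indicator of the open half-line. *)
Definition ramp (a : R) (n : nat) (x : R) : R :=
  clamp 1 (n%:R * Num.max (x - a) 0).

Lemma ramp_bc a n : continuous (ramp a n) /\ bounded_fun (ramp a n).
Proof.
apply: (clamp_comp_bc (g := fun x => n%:R * Num.max (x - a) 0)) => x.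
apply: cvgM; first exact: cvg_cst.
apply: (@continuous_max R R (fun x => x - a) (cst 0)); last exact: cst_continuous.
by apply: cvgB; [exact: cvg_id|exact: cvg_cst].
Qed.

Lemma cvg_ramp a x : ramp a n x @[n --> \oo] --> (\1_(`]a, +oo[) x : R).
Proof.
rewrite /ramp indicE mem_setE in_itv/= andbT.
have [xa|ax] := leP x a.
  rewrite max_r ?subr_le0//; apply: cvg_near_cst; near=> n.
  by rewrite mulr0 clamp_id// normr0.
rewrite max_l ?subr_ge0 ?ltW//; apply: cvg_near_cst; near=> n.
(* The ramp has reached height 1 at x as soon as n >= 1 / (x - a). *)
suff h : 1 <= n%:R * (x - a) by rewrite /clamp min_l// max_r//; lra.
rewrite -ler_pdivrMr ?subr_gt0// div1r.
by near: n; exact: nbhs_infty_ger.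
Unshelve. all: by end_near. Qed.

Lemma cvg_integral_ramp (Q : probability R R) a :
  (\int[Q]_x (ramp a n x)%:E)%E @[n --> \oo] --> Q `]a, +oo[%classic.
Proof.
have -> : Q `]a, +oo[%classic = (\int[Q]_x (\1_(`]a, +oo[) x)%:E)%E.
  by rewrite integral_indic// setIT.
have mr n : measurable_fun [set: R] (fun x => (ramp a n x)%:E).
  by apply/measurable_EFinP; apply: continuous_measurable_fun; have [] := ramp_bc a n.
have mi : measurable_fun [set: R] (fun x => (\1_(`]a, +oo[) x : R)%:E).
  by apply/measurable_EFinP; exact: measurable_indic.
have cvgr : {ae Q, forall x, [set: R] x ->
    (ramp a n x)%:E @[n --> \oo] --> ((\1_(`]a, +oo[) x : R)%:E)}.
  by apply: aeW => x _; apply/fine_cvgP; split; [exact: nearW|exact: cvg_ramp].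
have boundr : {ae Q, forall x n, [set: R] x ->
    (`|(ramp a n x)%:E| <= (EFin \o cst 1%R) x)%E}.
  by apply: aeW => x n _; rewrite /= lee_fin normr_clamp_le.
have i1 : Q.-integrable [set: R] (EFin \o cst 1).
  exact: finite_measure_integrable_cst.
by have [_ _] := dominated_convergence measurableT mr mi cvgr i1 boundr.
Qed.

(** Open half-lines are stable under intersection, generate the Borel sets, and exhaust the line
    along ]-n, +oo[. On each of them both measures are limits of the same ramp integrals. *)
Lemma eq_probability_bc (P Q : probability R R) :
  (forall f : R -> R, continuous f -> bounded_fun f ->
    (\int[P]_x (f x)%:E = \int[Q]_x (f x)%:E)%E) ->
  forall A : set R, measurable A -> P A = Q A.
Proof.
move=> PQ.
apply: (measure_unique (@RGenOInfty.G R) (fun n => `]- n%:R, +oo[%classic)).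
- exact: RGenOInfty.measurableE.
- move=> _ _ [x ->] [y ->]; exists (Num.max x y).
  apply/seteqP; split => z /=; rewrite !in_itv/= !andbT gt_max.
    by case=> -> ->.
  by move=> /andP[].
- by move=> n; exists (- n%:R).
- apply/seteqP; split => // x _; exists (Num.truncn `|x|).+1 => //=.
  rewrite in_itv/= andbT ltrNl (le_lt_trans (ler_norm (- x)))// normrN.
  exact: truncnS_gt.
- move=> _ [a ->].
  have hP : limn (fun n => \int[P]_x (ramp a n x)%:E)%E = P `]a, +oo[%classic.
    by apply: cvg_lim => //; exact: cvg_integral_ramp.
  have hQ : limn (fun n => \int[Q]_x (ramp a n x)%:E)%E = Q `]a, +oo[%classic.
    by apply: cvg_lim => //; exact: cvg_integral_ramp.
  apply: (eq_trans (esym hP)); apply: eq_trans hQ.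
  by congr (limn _); apply/funext => n; apply: PQ; have [] := ramp_bc a n.
- by move=> k; rewrite (le_lt_trans (probability_le1 _ _))// ltry.
Qed.

End weak_uniqueness.

(** * Construction of the mixture in the Giry monad *)

Lemma mnormalize_setT1 d (T : measurableType d) (R : realType)
    (nu : {measure set T -> \bar R}) (P : probability T R) (A : set T) :
  nu [set: T] = 1%E -> mnormalize nu P A = nu A.
Proof. by move=> nuT; rewrite /mnormalize nuT onee_eq0/= invr1 mule1. Qed.

Section mixture.
Context {R : realType} {dT : measure_display} {T : measurableType dT}.
Variables (mu : probability T R) (v : T -> R).
Hypothesis mv : measurable_fun [set: T] v.
Hypothesis v_ge0 : forall t, 0 <= v t.
Local Open Scope ereal_scope.

Let measurable_semicircle_giry :
  measurable_fun [set: T] (fun t => semicircle (v t) : giry R R).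
Proof.
apply: measurable_giry_codensity => // A mA.
exact: (measurableT_comp (measurable_semicircle mA) mv).
Qed.

Lemma measurable_integral_semicircle (h : R -> \bar R) :
  measurable_fun [set: R] h -> (forall x, 0 <= h x) ->
  measurable_fun [set: T] (fun t => \int[semicircle (v t)]_x h x).
Proof.
move=> mh h0.
exact: (measurableT_comp (measurable_giry_int mh h0) measurable_semicircle_giry).
Qed.

Lemma semicircle_mixture_exists : exists sigma : probability R R,
  forall h : R -> \bar R, measurable_fun [set: R] h -> (forall x, 0 <= h x) ->
  \int[sigma]_x h x = \int[mu]_t \int[semicircle (v t)]_x h x.
Proof.
pose nu : subprobability R R := giry_bind (mu : giry T R) measurable_semicircle_giry.
have nuE (h : R -> \bar R) : measurable_fun [set: R] h -> (forall x, 0 <= h x) ->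
    \int[nu]_x h x = \int[mu]_t \int[semicircle (v t)]_x h x.
  by move=> mh h0; exact: giry_int_bind.
(* The bind is only known to be a subprobability; its mass is 1 because every [v t] is
   nonnegative. *)
have nuT : nu [set: R] = 1.
  rewrite -[LHS]mul1e -integral_cst// nuE//.
  transitivity (\int[mu]_t cst 1 t).
    apply: eq_integral => t _; rewrite integral_cst// mul1e.
    exact: semicircle_setT.
  by rewrite integral_cst// mul1e; exact: probability_setT.
(* Normalizing a measure of mass 1 leaves it unchanged but makes it a [probability]; the Dirac mass
   is only the fallback value. *)
exists (mnormalize nu (\d_(0%R : R))) => h mh h0; rewrite -nuE//.
by apply: eq_measure_integral => A mA _; exact: mnormalize_setT1.
Qed.

Variable sigma : probability R R.
Hypothesis sigmaE : forall h : R -> \bar R,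
  measurable_fun [set: R] h -> (forall x, 0 <= h x) ->
  \int[sigma]_x h x = \int[mu]_t \int[semicircle (v t)]_x h x.

Lemma mixture_setE (A : set R) : measurable A ->
  sigma A = \int[mu]_t semicircle (v t) A.
Proof.
move=> mA; have := @sigmaE (EFin \o \1_A); rewrite integral_indic// setIT => ->.
- by apply: eq_integral => t _; rewrite integral_indic// setIT.
- by apply/measurable_EFinP; exact: measurable_indic.
- by move=> x; rewrite lee_fin.
Qed.

(** The formula for nonnegative functions is applied to the positive and negative parts of f. Their
    inner integrals are integrable in tau since f is bounded, so the two formulas may be
    subtracted. *)
Lemma mixture_is_semicircle_mixture : is_semicircle_mixture mu v sigma.
Proof.
move=> f cf bf.
have mf : measurable_fun [set: R] (EFin \o f).
  by apply/measurable_EFinP; exact: continuous_measurable_fun.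
have isf : sigma.-integrable [set: R] (EFin \o f).
  apply: measurable_bounded_integrable => //.
    by rewrite (le_lt_trans (probability_le1 _ _))// ltry.
  exact: continuous_measurable_fun.
have mp := measurable_funepos mf; have mn := measurable_funeneg mf.
have integrable_part (h : R -> \bar R) : measurable_fun [set: R] h ->
    (forall x, 0 <= h x) -> \int[sigma]_x h x < +oo ->
    mu.-integrable [set: T] (fun t => \int[semicircle (v t)]_x h x).
  move=> mh h0 hoo; apply/integrableP; split.
    exact: measurable_integral_semicircle.
  under eq_integral do rewrite gee0_abs ?integral_ge0//.
  by rewrite -sigmaE.
under [RHS]eq_integral do rewrite integralE.
rewrite integralB//=.
- by rewrite -!sigmaE// integralE.
- apply: integrable_part => //.
  exact: integral_funepos_lt_pinfty isf.
- apply: integrable_part => //.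
  exact: integral_funeneg_lt_pinfty isf.
Qed.

End mixture.

(** * Density of the absolutely continuous part *)

Section density.
Context {R : realType} {dT : measure_display} {T : measurableType dT}.
Variables (mu : probability T R) (v : T -> R).
Hypothesis mv : measurable_fun [set: T] v.
Hypothesis v_ge0 : forall t, 0 <= v t.
Local Notation leb := (@lebesgue_measure R).
Local Notation rho := (mixture_density (pushforward mu v)).

Lemma measurable_mixture_integrand (x : R) (D : set R) :
  measurable_fun D (fun t : R => (Num.sqrt (4 * t - x ^+ 2) / t)%:E).
Proof.
apply/measurable_EFinP; apply: measurable_funTS; apply: measurable_funM.
  apply: measurableT_comp; last by apply: measurable_funB => //; exact: measurable_funM.
  by apply: continuous_measurable_fun; exact: sqrt_continuous.
exact: measurable_invr.
Qed.

Lemma mixture_integrand_ge0 (x t : R) : x ^+ 2 / 4 <= t ->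
  (0 <= (Num.sqrt (4 * t - x ^+ 2) / t)%:E)%E.
Proof.
move=> xt; rewrite lee_fin divr_ge0 ?sqrtr_ge0//.
by rewrite (le_trans _ xt)// divr_ge0 ?sqr_ge0.
Qed.

(* Valid even at x = 0, where an atom of nu at 0 contributes Num.sqrt 0 / 0 = 0. *)
Lemma mixture_densityE (x : R) :
  rho x = (\int[mu]_t (semicircle_pdf (v t) x)%:E)%E.
Proof.
have mD : measurable (`[(x ^+ 2 / 4)%R, +oo[ : set R) by [].
have mvD : measurable (v @^-1` `[(x ^+ 2 / 4)%R, +oo[).
  by rewrite -[_ @^-1` _]setTI; exact: mv.
have c0 : (0 <= (2 * pi)^-1 :> R) by rewrite invr_ge0 mulr_ge0// pi_ge0.
rewrite /mixture_density (ge0_integral_pushforward mv) //; last 2 first.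
- exact: measurable_mixture_integrand.
- by move=> t; rewrite inE/= in_itv/= andbT; exact: mixture_integrand_ge0.
rewrite -ge0_integralZl//; last 2 first.
- apply: measurable_funTS.
  by apply: (measurableT_comp _ mv); exact: measurable_mixture_integrand.
- by move=> t; rewrite /preimage/= in_itv/= andbT; exact: mixture_integrand_ge0.
rewrite integral_mkcond; apply: eq_integral => t _.
rewrite patchE semicircle_pdfE; case: ifPn.
  by move=> _; rewrite /= -EFinM (invfM (2 * pi)) -mulrA (mulrC (v t)^-1).
(* Below the cutoff x^2 / 4 the radicand is negative, so the semicircle density is 0 there as
   well. *)
rewrite notin_setE /preimage/= in_itv/= andbT => /negP; rewrite -ltNge => vx.
by rewrite ler0_sqrtr ?mulr0//; lra.
Qed.

Let pdf_v (p : T * R) := (semicircle_pdf (v p.1) p.2)%:E.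

Let measurable_pdf_v : measurable_fun [set: T * R] pdf_v.
Proof.
apply/measurable_EFinP.
apply: (measurableT_comp (g := fun p : T * R => (v p.1, p.2))
  (@measurable_semicircle_pdf2 R)).
apply: measurable_fun_pair => //.
exact: measurableT_comp mv _.
Qed.

Let pdf_v_ge0 p : (0 <= pdf_v p)%E.
Proof. by rewrite lee_fin semicircle_pdf_ge0. Qed.

Lemma measurable_mixture_density : measurable_fun [set: R] rho.
Proof.
rewrite (_ : rho = fubini_G mu pdf_v); last first.
  by apply/funext => x; rewrite mixture_densityE.
exact: measurable_fun_fubini_tonelli_G.
Qed.

Lemma integral_mixture_density (A : set R) : measurable A ->
  (\int[mu]_t \int[leb]_(x in A) (semicircle_pdf (v t) x)%:E =
   \int[leb]_(x in A) rho x)%E.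
Proof.
move=> mA; pose f (p : T * R) := (pdf_v p * (\1_A p.2)%:E)%E.
transitivity (\int[mu]_t \int[leb]_x f (t, x))%E.
  apply: eq_integral => t _; rewrite integral_mkcond; apply: eq_integral => x _.
  by rewrite patchE /f indicE/=; case: ifPn; rewrite ?mule1 ?mule0.
rewrite fubini_tonelli//; last 2 first.
- apply: emeasurable_funM => //; apply/measurable_EFinP.
  by apply: measurableT_comp => //; exact: measurable_indic.
- by move=> p; rewrite mule_ge0// lee_fin.
rewrite [RHS]integral_mkcond; apply: eq_integral => x _.
rewrite patchE; case: ifPn => xA.
  rewrite mixture_densityE.
  by apply: eq_integral => t _; rewrite /f/= indicE xA mule1.
by rewrite integral0_eq// => t _; rewrite /f/= indicE (negbTE xA) mule0.
Qed.

Lemma mixture_densityN (x : R) : rho (- x) = rho x.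
Proof. by rewrite /mixture_density sqrrN. Qed.

Lemma mixture_density_lty (x : R) : 0 < `|x| -> (rho x < +oo)%E.
Proof.
move=> x0; rewrite mixture_densityE.
have x20 : 0 < x ^+ 2 by rewrite -real_normK ?num_real// exprn_gt0.
have pi0 := pi_gt0 R.
suff h w : semicircle_pdf w x <= (2 * pi)^-1 * (4 / `|x|).
  rewrite (@le_lt_trans _ _ (\int[mu]_t cst ((2 * pi)^-1 * (4 / `|x|))%:E t)%E)//.
    apply: ge0_le_integral => //.
    - by move=> t _; rewrite lee_fin semicircle_pdf_ge0.
    - exact: (measurable_fun_pair1 (f := pdf_v) x measurable_pdf_v).
    - by move=> t _; rewrite lee_fin.
  by rewrite integral_cst// [X in (_ * X)%E](@probability_setT _ _ _ mu) mule1 ltry.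
have [xw|xw] := leP (4 * w - x ^+ 2) 0.
  rewrite semicircle_pdfE ler0_sqrtr// mulr0 mulr_ge0// ?invr_ge0 ?divr_ge0//.
  by rewrite mulr_ge0// ltW.
have w0 : 0 < w by lra.
rewrite semicircle_pdfE invfM -mulrA ler_pM2l ?invr_gt0 ?mulr_gt0//.
rewrite ler_pdivrMl// -[leRHS]ger0_norm; last by rewrite mulr_ge0 ?divr_ge0// ltW.
(* After squaring, the claim is (4w - x^2) x^2 <= 16 w^2; the difference of the two sides is (4w -
   x^2/2)^2 + 3x^4/4. *)
rewrite -sqrtr_sqr ler_wsqrtr//.
rewrite exprMn expr_div_n real_normK ?num_real//.
rewrite mulrA ler_pdivlMr//; nra.
Qed.

Lemma mixture_density_le (x y : R) : `|x| <= `|y| -> (rho y <= rho x)%E.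
Proof.
move=> xy; rewrite !mixture_densityE; apply: ge0_le_integral => //.
- by move=> t _; rewrite lee_fin semicircle_pdf_ge0.
- exact: (measurable_fun_pair1 (f := pdf_v) y measurable_pdf_v).
- exact: (measurable_fun_pair1 (f := pdf_v) x measurable_pdf_v).
- move=> t _; rewrite lee_fin !semicircle_pdfE ler_wpM2l//.
    by rewrite invr_ge0 !mulr_ge0// pi_ge0.
  rewrite ler_wsqrtr// lerB// -[x ^+ 2]real_normK ?num_real//.
  by rewrite -[y ^+ 2]real_normK ?num_real// ler_sqr ?nnegrE.
Qed.

(** Integrating [semicircleE] over tau, the indicator of v = 0 yields the weight of the atom and
    Tonelli yields the density. *)
Lemma mixture_decomposition (A : set R) : measurable A ->
  (\int[mu]_t semicircle (v t) A =
   mu [set t | v t = 0%R] * \d_(0%R : R) A + \int[leb]_(x in A) rho x)%E.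
Proof.
move=> mA; under eq_integral do rewrite semicircleE//.
have mv0 : measurable [set t | v t = 0].
  by have := mv measurableT (measurable_set1 0); rewrite setTI.
have mi : measurable_fun [set: T] (fun t => (\1_[set 0%R] (v t) : R)%:E).
  by apply/measurable_EFinP; apply: measurableT_comp => //; exact: measurable_indic.
rewrite ge0_integralD//; last 4 first.
- by move=> t _; rewrite mule_ge0// lee_fin.
- exact: emeasurable_funM.
- by move=> t _; apply: integral_ge0 => x _; rewrite lee_fin semicircle_pdf_ge0.
- exact: (measurableT_comp (measurable_integral_semicircle_pdf mA) mv).
rewrite integral_mixture_density//; congr (_ + _)%E.
rewrite ge0_integralZr//; congr (_ * _)%E.
transitivity (\int[mu]_t (\1_[set t | v t = 0%R] t)%:E)%E.
  apply: eq_integral => t _; rewrite !indicE.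
  suff -> : (v t \in [set 0]) = (t \in [set t | v t = 0]) by [].
  by apply/idP/idP; rewrite !inE.
by rewrite integral_indic// setIT.
Qed.

End density.

(** * Existence, uniqueness and structure of the mixture *)

Theorem proposition26 (R : realType)
    (d : measure_display) (Omega : measurableType d) (P : probability Omega R)
    (xi : nat -> {RV P >-> R})
    (dT : measure_display) (T : measurableType dT) (mu : probability T R)
    (Lam : T -> probability R R) :
  let v : T -> R := fun tau => var (Lam tau) in
  let nu : set R -> \bar R := pushforward mu v in
  let rho : R -> \bar R := mixture_density nu in
  exchangeable xi ->
  finite_moments xi ->
  de_finetti_representation xi mu Lam ->
  exists2 sigma : probability R R,
    is_semicircle_mixture mu v sigma /\
    (forall sigma' : probability R R, is_semicircle_mixture mu v sigma' ->
       forall A : set R, measurable A -> sigma' A = sigma A)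
  & [/\ forall A : set R, measurable A -> sigma A = sigma [set - x | x in A],
        exists sigma_abs : {measure set R -> \bar R},
          [/\ forall A : set R, measurable A ->
                sigma A =
                  (mu [set tau | v tau = 0%R] * \d_(0%R : R) A + sigma_abs A)%E,
              sigma_abs `<< lebesgue_measure,
              measurable_fun [set: R] rho
            & forall A : set R, measurable A ->
                sigma_abs A = (\int[lebesgue_measure]_(x in A) rho x)%E],
        forall x : R, 0 < `|x| -> (rho x < +oo)%E,
        forall x : R, 0 < `|x| -> rho (- x) = rho x
      & forall x y : R, 0 < `|x| -> `|x| <= `|y| -> (rho y <= rho x)%E].
Proof.
move=> v nu rho _ _ [mLam _ iLam].
have mv : measurable_fun [set: T] v by exact: measurable_var.
have v0 t : 0 <= v t by apply: var_ge0; exact: iLam.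
have [sigma sigmaE] := semicircle_mixture_exists mu mv v0.
have sigma_mix := mixture_is_semicircle_mixture mv sigmaE.
have sigmaA := mixture_setE sigmaE.
have mrho : measurable_fun [set: R] rho by exact: measurable_mixture_density.
exists sigma.
  split=> // sigma' sigma'_mix; apply: eq_probability_bc => f cf bf.
  by rewrite sigma'_mix// sigma_mix.
(* The absolutely continuous part is taken to be the restriction of [sigma] to the complement of 0,
   which is already a measure. *)
have mD : measurable (~` [set 0 : R]) by exact: measurableC.
have sigmaD0 A : measurable A ->
    mrestr sigma mD A = (\int[lebesgue_measure]_(x in A) rho x)%E.
  move=> mA; have mAD : measurable (A `&` ~` [set 0 : R]) by exact: measurableI.
  rewrite /mrestr sigmaA// mixture_decomposition// diracE memNset; last by case=> _; apply.
  (* Off 0 the Dirac term vanishes, and deleting the Lebesgue-null point 0 does not change the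
     integral, even if [rho] is infinite there. *)
  by rewrite mule0 add0e -setDE integral_setD1//; exact: measurable_funTS.
split.
- move=> A mA; rewrite !sigmaA//; last exact: measurable_image_opp.
  by apply: eq_integral => t _; rewrite semicircleN.
- exists (mrestr sigma mD); split=> //.
  + move=> A mA; rewrite sigmaA// mixture_decomposition//; congr (_ + _)%E.
    exact/esym/sigmaD0.
  + apply/null_content_dominatesP => A mA A0.
    apply: (eq_trans (sigmaD0 A mA)).
    by apply: null_set_integral => //; exact: measurable_funTS.
- by move=> x; exact: mixture_density_lty.
- by move=> x _; exact: mixture_densityN.
- by move=> x y _; apply: mixture_density_le.
Qed.
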